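(* Consider the $2\times2$ pressureless gas system $\partial_t\rho+\partial_x(\rho u)=0$, $\partial_t(\rho u)+\partial_x(\rho u^2)=0$ with the entropy $\eta(\rho,u)=\frac12\rho u^2$, or the $3\times3$ pressureless gas system obtained by adding $\partial_t(\rho u^2/2+\rho e)+\partial_x((\rho u^2/2+\rho e)u)=0$ with an entropy $\eta(\rho,u,e)=\rho(R(u)+S(e))$, where $R''\ge0$, $S'\le0$ and $S''\ge0$. In both cases the total entropy decreases after the interaction between two shadow waves: if two shadow waves interact at time $T$ and $\mathcal{E}^-(t)$, $t<T$, and $\mathcal{E}^+(t)$, $t>T$, denote the total entropies before and after the interaction, then $\mathcal{E}^+(T+0)\le\mathcal{E}^-(T-0)$.
   Context: A shadow wave is a net of functions which, as $\varepsilon\to0$, equals a left state for $x<c(t)$, a right state for $x>c(t)$, and in a strip of width of order $\varepsilon$ around $x=c(t)$ takes an intermediate state $U_\varepsilon(t)$ with density $\rho_\varepsilon(t)$ of order $\varepsilon^{-1}$. Its strength is $\xi(t)=\lim_{\varepsilon\to0}(\text{strip width})\cdot\rho_\varepsilon(t)>0$, its speed is $c'(t)=u_s(t)=\lim_{\varepsilon\to0} u_\varepsilon(t)$ and (for the $3\times3$ system) its internal energy is $e_s(t)=\lim_{\varepsilon\to0} e_\varepsilon(t)$. The total entropy at time $t$ is $\mathcal{E}(t)=\lim_{\varepsilon\to0}\int_{-M}^M\eta(U^\varepsilon(x,t))\,dx$ for a fixed large $M>0$; thus each shadow wave contributes $\frac12\xi(t)u_s(t)^2$ for the $2\times2$ system,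 respectively $\xi(t)\big(R(u_s(t))+S(e_s(t))\big)$ for the $3\times3$ system, in addition to the integrals of $\eta$ over the regular states. Interaction: two shadow waves, the left one joining states $U_l,U_m$ with strength, speed (and internal energy) $\xi_l,u_{s_l},(e_{s_l})$ and the right one joining $U_m,U_r$ with $\xi_r,u_{s_r},(e_{s_r})$, meet at time $T$ and are replaced by a single shadow wave joining $U_l,U_r$ with $\xi,u_s,(e_s)$, where mass, momentum (and energy) are conserved at $t=T$: $\xi(T)=\xi_l(T)+\xi_r(T)$, $\xi(T)u_s(T)=\xi_l(T)u_{s_l}(T)+\xi_r(T)u_{s_r}(T)$, and for the $3\times3$ system $\xi\big(\frac{u_s^2}{2}+e_s\big)=\xi_l\big(\frac{u_{s_l}^2}{2}+e_{s_l}\big)+\xi_r\big(\frac{u_{s_r}^2}{2}+e_{s_r}\big)$ at $t=T$. *)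

(* Defs.v *)
(* Built on the Stdlib reals and Coquelicot.

   A state is a pair (rho, v) : R * V, where rho is the density and v collects
   the variables that stay bounded inside a shadow wave:
     V = R,      v = u       for the 2x2 system,
     V = R * R,  v = (u, e)  for the 3x3 system.
   A field of states is a function of (x, t), in this order; a net of fields
   is a function of (eps, x, t), and its limits are taken as eps -> 0+. *)
From Stdlib Require Import Reals List.
From Coquelicot Require Import Coquelicot.
Import ListNotations.
Open Scope R_scope.

(* A conservation law  d_t q(U) + d_x f(U) = 0  is the pair (q, f). *)
Definition conservation_laws (V : UniformSpace) : Type :=
  list ((R * V -> R) * (R * V -> R)).

Definition vel2 (v : R) : R := v.

Definition pressureless2 : conservation_laws R_UniformSpace :=
  [ (fun '(rho, u) => rho,     fun '(rho, u) => rho * u);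
    (fun '(rho, u) => rho * u, fun '(rho, u) => rho * u ^ 2) ].

Definition eta2 : R * R -> R := fun '(rho, u) => / 2 * rho * u ^ 2.

Definition vel3 (v : R * R) : R := fst v.
Definition energy3 (v : R * R) : R := snd v.

Definition pressureless3 :
    conservation_laws (prod_UniformSpace R_UniformSpace R_UniformSpace) :=
  [ (fun '(rho, (u, e)) => rho,
     fun '(rho, (u, e)) => rho * u);
    (fun '(rho, (u, e)) => rho * u,
     fun '(rho, (u, e)) => rho * u ^ 2);
    (fun '(rho, (u, e)) => rho * u ^ 2 / 2 + rho * e,
     fun '(rho, (u, e)) => (rho * u ^ 2 / 2 + rho * e) * u) ].

Definition eta3 (Ru Se : R -> R) : R * (R * R) -> R :=
  fun '(rho, (u, e)) => rho * (Ru u + Se e).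

(* The derivatives are required to exist separately because [Derive] is total. *)
Definition twice_derivable_at (f : R -> R) (x : R) : Prop :=
  ex_derive f x /\ ex_derive (Derive f) x.

Definition is_open_interval (J : R -> Prop) : Prop :=
  open J /\ forall x y z : R, J x -> J y -> x <= z <= y -> J z.

(* D i j is the mixed derivative of order i in x and j in t. *)
Definition smooth2 (phi : R -> R -> R) : Prop :=
  exists D : nat -> nat -> R -> R -> R,
    (forall x t, D 0%nat 0%nat x t = phi x t) /\
    forall i j x t,
      continuous (fun p : R * R => D i j (fst p) (snd p)) (x, t) /\
      is_derive (fun y => D i j y t) x (D (S i) j x t) /\
      is_derive (fun s => D i j x s) t (D i (S j) x t).

(* The net U satisfies the system on R x (t1, t2) in the limit eps -> 0+, in
   the sense of distributions.  The test function phi is supported in the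
   compact box [-L, L] x [s1, s2] of R x (t1, t2), so that the integrals over
   this box are the integrals over the plane. *)
Definition solves_in_limit {V : UniformSpace} (laws : conservation_laws V)
    (t1 t2 : R) (U : R -> R -> R -> R * V) : Prop :=
  forall q f, In (q, f) laws ->
  forall (phi : R -> R -> R) (L s1 s2 : R),
    0 < L -> t1 < s1 -> s1 < s2 -> s2 < t2 ->
    smooth2 phi ->
    (forall x t, ~ (- L <= x <= L /\ s1 <= t <= s2) -> phi x t = 0) ->
    let integrand eps t x :=
      q (U eps x t) * Derive (fun s => phi x s) t
      + f (U eps x t) * Derive (fun y => phi y t) x in
    exists I : R -> R,
      at_right 0 (fun eps =>
        (forall t, s1 <= t <= s2 -> ex_RInt (integrand eps t) (- L) L) /\
        is_RInt (fun t => RInt (integrand eps t) (- L) L) s1 s2 (I eps)) /\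
      filterlim I (at_right 0) (locally 0).

(* The strip of the wave at time t is [center t - lwidth eps t, center t + rwidth eps t],
   in which the net takes the value [mid eps t].  [strength] is xi and [val] is
   the limit of the v-component of [mid]: u_s, respectively (u_s, e_s). *)
Record shadow_wave (V : UniformSpace) : Type := ShadowWave {
  center : R -> R;
  lwidth : R -> R -> R;
  rwidth : R -> R -> R;
  mid : R -> R -> R * V;
  strength : R -> R;
  val : R -> V
}.
Arguments center {V}.
Arguments lwidth {V}.
Arguments rwidth {V}.
Arguments mid {V}.
Arguments strength {V}.
Arguments val {V}.

Definition lo {V} (w : shadow_wave V) (eps t : R) : R := center w t - lwidth w eps t.
Definition hi {V} (w : shadow_wave V) (eps t : R) : R := center w t + rwidth w eps t.
Definition width {V} (w : shadow_wave V) (eps t : R) : R :=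
  lwidth w eps t + rwidth w eps t.

Definition same_order (f g : R -> R) : Prop :=
  exists k K : R, 0 < k /\ 0 < K /\
    at_right 0 (fun eps => k * g eps <= f eps <= K * g eps).

Definition is_shadow_wave {V : UniformSpace} (vel : V -> R) (t1 t2 : R)
    (w : shadow_wave V) : Prop :=
  forall t, t1 < t < t2 ->
    at_right 0 (fun eps => 0 <= lwidth w eps t /\ 0 <= rwidth w eps t) /\
    same_order (fun eps => width w eps t) (fun eps => eps) /\
    same_order (fun eps => fst (mid w eps t)) (fun eps => / eps) /\
    filterlim (fun eps => width w eps t * fst (mid w eps t))
      (at_right 0) (locally (strength w t)) /\
    0 < strength w t /\
    filterlim (fun eps => snd (mid w eps t)) (at_right 0) (locally (val w t)) /\
    is_derive (center w) t (vel (val w t)).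

Definition one_wave_net {V : UniformSpace} (Ul : R -> R -> R * V)
    (w : shadow_wave V) (Ur : R -> R -> R * V) (eps x t : R) : R * V :=
  if Rlt_dec x (lo w eps t) then Ul x t
  else if Rle_dec x (hi w eps t) then mid w eps t
  else Ur x t.

Definition two_wave_net {V : UniformSpace} (Ul : R -> R -> R * V)
    (wl : shadow_wave V) (Um : R -> R -> R * V) (wr : shadow_wave V)
    (Ur : R -> R -> R * V) (eps x t : R) : R * V :=
  if Rlt_dec x (lo wl eps t) then Ul x t
  else if Rle_dec x (hi wl eps t) then mid wl eps t
  else one_wave_net Um wr Ur eps x t.

(* Applied with F = at_left T or at_right T: the values at time T are the
   one-sided limits there. *)
Definition attains_limits {V : UniformSpace} (F : (R -> Prop) -> Prop) (T : R)
    (w : shadow_wave V) : Prop :=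
  filterlim (center w) F (locally (center w T)) /\
  filterlim (strength w) F (locally (strength w T)) /\
  filterlim (val w) F (locally (val w T)).

Definition regular_state {V : UniformSpace} (t1 t2 : R) (U : R -> R -> R * V) :
    Prop :=
  forall x t, t1 < t < t2 ->
    continuous (fun p : R * R => U (fst p) (snd p)) (x, t).

(* The waves wl (joining Ul, Um) and wr (joining Um, Ur), present on (T0, T),
   meet at time T and are replaced on (T, T1) by w (joining Ul, Ur). *)
Record interaction {V : UniformSpace} (laws : conservation_laws V) (vel : V -> R)
    (T0 T T1 : R) (Ul Um Ur : R -> R -> R * V) (wl wr w : shadow_wave V) : Prop := {
  int_times : T0 < T < T1;
  int_Ul : regular_state T0 T1 Ul;
  int_Um : regular_state T0 T1 Um;
  int_Ur : regular_state T0 T1 Ur;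
  int_wl : is_shadow_wave vel T0 T wl;
  int_wr : is_shadow_wave vel T0 T wr;
  int_w : is_shadow_wave vel T T1 w;
  int_before : solves_in_limit laws T0 T (two_wave_net Ul wl Um wr Ur);
  int_after : solves_in_limit laws T T1 (one_wave_net Ul w Ur);
  int_ordered : forall t, T0 < t < T -> center wl t < center wr t;
  int_wl_T : attains_limits (at_left T) T wl;
  int_wr_T : attains_limits (at_left T) T wr;
  int_w_T : attains_limits (at_right T) T w;
  int_meet_l : center wl T = center w T;
  int_meet_r : center wr T = center w T;
  int_mass : strength w T = strength wl T + strength wr T;
  int_momentum :
    strength w T * vel (val w T)
    = strength wl T * vel (val wl T) + strength wr T * vel (val wr T)
}.

Definition total_energy (w : shadow_wave (prod_UniformSpace R_UniformSpace R_UniformSpace))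
    (t : R) : R :=
  strength w t * (vel3 (val w t) ^ 2 / 2 + energy3 (val w t)).

(* E = lim_{eps -> 0+} int_{-M}^{M} eta (U eps x t) dx, integrals and limit
   being required to exist. *)
Definition is_total_entropy {V : UniformSpace} (eta : R * V -> R) (M : R)
    (U : R -> R -> R -> R * V) (t E : R) : Prop :=
  exists I : R -> R,
    at_right 0 (fun eps => is_RInt (fun x => eta (U eps x t)) (- M) M (I eps)) /\
    filterlim I (at_right 0) (locally E).

(* E^+(T+0) <= E^-(T-0), where E^- and E^+ are the total entropies of the nets
   Ubefore and Uafter; they and both one-sided limits are claimed to exist. *)
Definition total_entropy_decreases {V : UniformSpace} (eta : R * V -> R) (M T : R)
    (Ubefore Uafter : R -> R -> R -> R * V) : Prop :=
  exists (Eminus Eplus : R -> R) (lminus lplus : R),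
    at_left T (fun t => is_total_entropy eta M Ubefore t (Eminus t)) /\
    at_right T (fun t => is_total_entropy eta M Uafter t (Eplus t)) /\
    filterlim Eminus (at_left T) (locally lminus) /\
    filterlim Eplus (at_right T) (locally lplus) /\
    lplus <= lminus.

(* Main.v *)
(** Near the interaction time the total entropy is a sum of integrals of [eta]
    over the regular regions and of one term [xi * H v] per wave, where
    [eta (rho, v) = rho * H v]. The integrals are continuous in time through [T]
    (the middle region shrinks to a point), so the claim reduces to
    [xi * H v <= xi_l * H v_l + xi_r * H v_r] at [T]. The velocity after merging
    is the mass-weighted mean, so the kinetic part is Jensen's inequality.
    Jensen for [u^2] shows that merging loses kinetic energy, so the internal
    energy is at least the mean; the tangent line of the convex
    nonincreasing [Se] at the new internal energy then gives the thermal part. *)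
Require Import Defs.
From Stdlib Require Import Reals List Lra.
From Coquelicot Require Import Coquelicot.
Open Scope R_scope.

(** * Limits along filters and integrals depending on a parameter *)

Lemma filterlim_Rplus {A : Type} (F : (A -> Prop) -> Prop) {FF : Filter F}
    (f g : A -> R) (a b : R) :
  filterlim f F (locally a) -> filterlim g F (locally b) ->
  filterlim (fun i => f i + g i) F (locally (a + b)).
Proof.
  intros Hf Hg.
  eapply filterlim_comp_2;
    [exact Hf | exact Hg | exact (@filterlim_plus R_AbsRing R_NormedModule a b)].
Qed.

Lemma filterlim_Rmult {A : Type} (F : (A -> Prop) -> Prop) {FF : Filter F}
    (f g : A -> R) (a b : R) :
  filterlim f F (locally a) -> filterlim g F (locally b) ->
  filterlim (fun i => f i * g i) F (locally (a * b)).
Proof.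
  intros Hf Hg.
  eapply filterlim_comp_2;
    [exact Hf | exact Hg | exact (@filterlim_mult R_AbsRing a b)].
Qed.

Lemma at_left_Ioo (a b : R) : a < b -> at_left b (fun t => a < t < b).
Proof.
  intros Hab. apply filter_and.
  - apply (filter_le_within _ (fun t => a < t)). now apply (open_gt a).
  - exists (mkposreal 1 Rlt_0_1). intros t _ Ht. exact Ht.
Qed.

Lemma at_right_Ioo (a b : R) : a < b -> at_right a (fun t => a < t < b).
Proof.
  intros Hab. apply filter_and.
  - exists (mkposreal 1 Rlt_0_1). intros t _ Ht. exact Ht.
  - apply (filter_le_within _ (fun t => t < b)). now apply (open_lt b).
Qed.

(** The error splits in two. With the parameter frozen at [t], moving the endpoints is handled by
    continuity of the integral in its bounds; with the endpoints frozen, moving the parameter is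
    handled by uniform continuity of [g] near a compact segment. The same statement serves both the
    limit [eps -> 0] at a fixed time and the limit in time. *)
Lemma filterlim_RInt_param {A : Type} (F : (A -> Prop) -> Prop) {FF : Filter F}
    (g : R -> R -> R) (t1 t2 t : R) (a b s : A -> R) (a0 b0 : R) :
  (forall x t, t1 < t < t2 ->
     continuous (fun p : R * R => g (fst p) (snd p)) (x, t)) ->
  t1 < t < t2 ->
  filterlim a F (locally a0) -> filterlim b F (locally b0) ->
  filterlim s F (locally t) ->
  filterlim (fun i => RInt (fun x => g x (s i)) (a i) (b i)) F
    (locally (RInt (fun x => g x t) a0 b0)).
Proof.
  intros Hg Ht Ha Hb Hs.
  assert (Hgx : forall x t, t1 < t < t2 -> continuous (fun x => g x t) x).
  { intros x t' Ht'.
    apply (continuous_comp_2 (fun x : R => x) (fun _ => t') g).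
    - apply continuous_id.
    - apply continuous_const.
    - exact (Hg x t' Ht'). }
  assert (HI : forall t' u v, t1 < t' < t2 -> ex_RInt (fun x => g x t') u v).
  { intros t' u v Ht'. apply (@ex_RInt_continuous R_CompleteNormedModule).
    intros z _. now apply Hgx. }
  (* Once [a i] and [b i] are within 1 of their limits, both lie in [[- N, N]]. *)
  set (N := Rabs a0 + Rabs b0 + 1).
  assert (HN : 0 < N) by (unfold N; generalize (Rabs_pos a0) (Rabs_pos b0); lra).
  apply (proj2 (filterlim_locally _ _)). intros eps.
  (* The interval of integration has length at most [2 * N], so this tolerance on the integrand
     costs at most [2 * N * eps / (4 * N + 4)], which is strictly less than [eps / 2]. *)
  assert (Hd : 0 < eps / (4 * N + 4)).
  { apply Rdiv_lt_0_compat; [apply cond_pos | lra]. }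
  destruct (uniform_continuity_2d_1d g (- N) N t) with (eps := mkposreal _ Hd)
    as [delta Hdelta].
  { intros x _. apply continuity_2d_pt_filterlim. exact (Hg x t Ht). }
  assert (Hfix : filterlim (fun i => RInt (fun x => g x t) (a i) (b i)) F
                   (locally (RInt (fun x => g x t) a0 b0))).
  { eapply (filterlim_comp_2 a b (fun u v => RInt (fun x => g x t) u v));
      [exact Ha | exact Hb |].
    intros P HP.
    assert (Hc : continuous (fun z : R * R => RInt (fun x => g x t) (fst z) (snd z))
                   (a0, b0)).
    { apply (continuous_RInt (fun x => g x t) a0 b0
               (fun u v => RInt (fun x => g x t) u v)).
      apply filter_forall. intros z. apply (@RInt_correct R_CompleteNormedModule).
      now apply HI. }
    (* A neighbourhood of [(a0, b0)] contains a product of balls, which is the form the product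
       filter asks for. *)
    specialize (Hc P HP). destruct Hc as [d Hc].
    exists (fun u => ball a0 d u) (fun v => ball b0 d v).
    - now exists d.
    - now exists d.
    - intros u v Hu Hv. apply Hc. now split. }
  assert (He2 : 0 < eps / 2) by (generalize (cond_pos eps); lra).
  pose proof (proj1 (filterlim_locally _ _) Hfix (mkposreal _ He2)) as E1.
  pose proof (proj1 (filterlim_locally _ _) Ha (mkposreal 1 Rlt_0_1)) as E2.
  pose proof (proj1 (filterlim_locally _ _) Hb (mkposreal 1 Rlt_0_1)) as E3.
  pose proof (proj1 (filterlim_locally _ _) Hs delta) as E4.
  (* This radius keeps [s i] in [(t1, t2)], where the integrals exist. *)
  assert (Hm : 0 < Rmin (t - t1) (t2 - t)) by (apply Rmin_pos; lra).
  pose proof (proj1 (filterlim_locally _ _) Hs (mkposreal _ Hm)) as E5.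
  generalize (filter_and _ _ E1 (filter_and _ _ E2 (filter_and _ _ E3
    (filter_and _ _ E4 E5)))).
  apply filter_imp. clear E1 E2 E3 E4 E5.
  intros i (E1 & E2 & E3 & E4 & E5).
  change (Rabs (RInt (fun x => g x t) (a i) (b i) - RInt (fun x => g x t) a0 b0) < eps / 2) in E1.
  change (Rabs (a i - a0) < 1) in E2.
  change (Rabs (b i - b0) < 1) in E3.
  change (Rabs (s i - t) < delta) in E4.
  change (Rabs (s i - t) < Rmin (t - t1) (t2 - t)) in E5.
  change (Rabs (RInt (fun x => g x (s i)) (a i) (b i) - RInt (fun x => g x t) a0 b0) < eps).
  assert (Hsi : t1 < s i < t2).
  { generalize (Rmin_l (t - t1) (t2 - t)) (Rmin_r (t - t1) (t2 - t)).
    apply Rabs_def2 in E5. lra. }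
  assert (Hai : - N <= a i <= N).
  { unfold N. apply Rabs_def2 in E2.
    generalize (Rabs_pos b0) (Rle_abs a0) (Rle_abs (- a0)). rewrite Rabs_Ropp. lra. }
  assert (Hbi : - N <= b i <= N).
  { unfold N. apply Rabs_def2 in E3.
    generalize (Rabs_pos a0) (Rle_abs b0) (Rle_abs (- b0)). rewrite Rabs_Ropp. lra. }
  assert (Hdiff : Rabs (RInt (fun x => g x (s i)) (a i) (b i)
                        - RInt (fun x => g x t) (a i) (b i))
                  <= Rabs (b i - a i) * (eps / (4 * N + 4))).
  { apply (norm_RInt_le_const_abs (V := R_NormedModule)
             (fun x => minus (g x (s i)) (g x t)) (a i) (b i)).
    - intros x Hx. left.
      assert (Hx' : - N <= x <= N).
      { revert Hx. unfold Rmin, Rmax. destruct (Rle_dec (a i) (b i)); lra. }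
      apply (Hdelta x t x (s i)); trivial.
      + generalize (cond_pos delta); lra.
      + apply Rabs_def2 in E4. lra.
      + unfold Rminus. rewrite Rplus_opp_r, Rabs_R0. apply cond_pos.
    - apply (is_RInt_minus (V := R_NormedModule));
        apply (@RInt_correct R_CompleteNormedModule); now apply HI. }
  assert (Hba : Rabs (b i - a i) <= 2 * N).
  { apply Rabs_le. lra. }
  assert (Hq : Rabs (b i - a i) * (eps / (4 * N + 4)) < eps / 2).
  { apply Rle_lt_trans with (2 * N * (eps / (4 * N + 4))).
    - apply Rmult_le_compat_r; lra.
    - replace (eps / 2) with ((2 * N + 2) * (eps / (4 * N + 4))) by (field; lra).
      apply Rmult_lt_compat_r; lra. }
  replace (_ - _) with ((RInt (fun x => g x (s i)) (a i) (b i)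
                        - RInt (fun x => g x t) (a i) (b i))
     + (RInt (fun x => g x t) (a i) (b i) - RInt (fun x => g x t) a0 b0)) by ring.
  eapply Rle_lt_trans; [apply Rabs_triang |]. lra.
Qed.

(** Chasles at [p] and [q]; on each piece the integrand has to agree only on the open interval, so
    the strict and non-strict tests at the ends are harmless. The right function [r] may itself be a
    net with a wave, which allows nesting for two waves. *)
Lemma is_RInt_strip {X : Type} (f : X -> R) (l r : R -> X) (m : X)
    (a p q b Il Ir : R) :
  a <= p <= q -> q <= b ->
  is_RInt (fun x => f (l x)) a p Il -> is_RInt (fun x => f (r x)) q b Ir ->
  is_RInt (fun x => f (if Rlt_dec x p then l x else if Rle_dec x q then m else r x))
    a b (Il + ((q - p) * f m + Ir)).
Proof.
  intros Hapq Hqb HIl HIr.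
  apply (is_RInt_Chasles (V := R_NormedModule) _ a p b).
  - apply (is_RInt_ext (V := R_NormedModule) (fun x => f (l x))); [| exact HIl].
    intros x. rewrite Rmin_left, Rmax_right by lra. intros Hx.
    destruct (Rlt_dec x p); [reflexivity | lra].
  - apply (is_RInt_Chasles (V := R_NormedModule) _ p q b).
    + apply (is_RInt_ext (V := R_NormedModule) (fun _ => f m));
        [| exact (is_RInt_const (V := R_NormedModule) p q (f m))].
      intros x. rewrite Rmin_left, Rmax_right by lra. intros Hx.
      destruct (Rlt_dec x p); [lra |]. destruct (Rle_dec x q); [reflexivity | lra].
    + apply (is_RInt_ext (V := R_NormedModule) (fun x => f (r x))); [| exact HIr].
      intros x. rewrite Rmin_left, Rmax_right by lra. intros Hx.
      destruct (Rlt_dec x p); [lra |]. destruct (Rle_dec x q); [lra | reflexivity].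
Qed.

(** * Total entropy of nets with shadow waves *)

Section Waves.

(** Both entropies are linear in the density. This is why a strip of width of order [eps] carrying a
    density of order [/ eps] has a finite entropy in the limit. *)
Context {V : UniformSpace} (vel : V -> R) (eta : R * V -> R) (H : V -> R)
  (eta_linear : forall z, eta z = fst z * H (snd z)).

(** The two half-widths are nonnegative and their sum is at most [K * eps], so each tends to 0. *)
Lemma strip_ends_lim (t1 t2 t : R) (w : shadow_wave V) :
  is_shadow_wave vel t1 t2 w -> t1 < t < t2 ->
  filterlim (fun eps => lo w eps t) (at_right 0) (locally (center w t)) /\
  filterlim (fun eps => hi w eps t) (at_right 0) (locally (center w t)).
Proof.
  intros Hw Ht.
  destruct (Hw t Ht) as (Hpos & (k & K & Hk & HK & Hord) & _).
  assert (Hsmall : forall eps : posreal, at_right 0 (fun e =>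
    (0 <= lwidth w e t < eps) /\ (0 <= rwidth w e t < eps))).
  { intros eps.
    assert (He : 0 < eps / K) by (apply Rdiv_lt_0_compat; [apply cond_pos | lra]).
    assert (Hnear : at_right 0 (fun e => e < eps / K)).
    { exists (mkposreal _ He). intros e Hb _.
      change (Rabs (e - 0) < eps / K) in Hb. apply Rabs_def2 in Hb. lra. }
    generalize (filter_and _ _ Hpos (filter_and _ _ Hord Hnear)).
    apply filter_imp. intros e (Hp & Ho & He').
    assert (K * e < eps).
    { replace (pos eps) with (K * (eps / K)) by (field; lra).
      now apply Rmult_lt_compat_l. }
    unfold width in Ho. lra. }
  split; apply (proj2 (filterlim_locally _ _)); intros eps;
    generalize (Hsmall eps); apply filter_imp; intros e He.
  - change (Rabs (center w t - lwidth w e t - center w t) < eps).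
    apply Rabs_def1; lra.
  - change (Rabs (center w t + rwidth w e t - center w t) < eps).
    apply Rabs_def1; lra.
Qed.

(** By linearity in the density the product regroups as (width times density) times [H] of the
    bounded variables; the first factor tends to the strength and the second converges by continuity
    of [H]. *)
Lemma strip_entropy_lim (t1 t2 t : R) (w : shadow_wave V) :
  is_shadow_wave vel t1 t2 w -> t1 < t < t2 -> continuous H (val w t) ->
  filterlim (fun eps => (hi w eps t - lo w eps t) * eta (mid w eps t)) (at_right 0)
    (locally (strength w t * H (val w t))).
Proof.
  intros Hw Ht HH.
  destruct (Hw t Ht) as (_ & _ & _ & Hxi & _ & Hval & _).
  apply filterlim_ext with
    (fun eps => width w eps t * fst (mid w eps t) * H (snd (mid w eps t))).
  { intros eps. rewrite eta_linear. unfold hi, lo, width. ring. }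
  apply filterlim_Rmult; trivial; try typeclasses eauto.
  exact (filterlim_comp _ _ _ _ H _ _ _ Hval HH).
Qed.

Lemma continuous_eta (z : R * V) : continuous H (snd z) -> continuous eta z.
Proof.
  intros HH. apply (continuous_ext (fun z : R * V => mult (K := R_AbsRing) (fst z) (H (snd z)))).
  { intros y. symmetry. apply eta_linear. }
  apply (continuous_mult (K := R_AbsRing) (fun z : R * V => fst z)
           (fun z : R * V => H (snd z))).
  - destruct z. apply continuous_fst.
  - apply (continuous_comp (fun z : R * V => snd z) H); trivial.
    destruct z. apply continuous_snd.
Qed.

Lemma continuous_eta_state (t1 t2 : R) (U : R -> R -> R * V) :
  regular_state t1 t2 U ->
  (forall x t, t1 < t < t2 -> continuous H (snd (U x t))) ->
  forall x t, t1 < t < t2 ->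
    continuous (fun p : R * R => eta (U (fst p) (snd p))) (x, t).
Proof.
  intros HU HH x t Ht.
  apply (continuous_comp (fun p : R * R => U (fst p) (snd p)) eta).
  - now apply HU.
  - apply continuous_eta. now apply HH.
Qed.

Lemma is_RInt_eta_state (t1 t2 t : R) (U : R -> R -> R * V) (a b : R) :
  (forall x t, t1 < t < t2 ->
    continuous (fun p : R * R => eta (U (fst p) (snd p))) (x, t)) ->
  t1 < t < t2 ->
  is_RInt (fun x => eta (U x t)) a b (RInt (fun x => eta (U x t)) a b).
Proof.
  intros HU Ht. apply (@RInt_correct R_CompleteNormedModule).
  apply (@ex_RInt_continuous R_CompleteNormedModule). intros x _.
  apply (continuous_comp_2 (fun x : R => x) (fun _ => t) (fun x t => eta (U x t))).
  - apply continuous_id.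
  - apply continuous_const.
  - now apply HU.
Qed.

(** For small [eps] the strip lies inside [(- M, M)], so the integral splits into three pieces that
    converge separately. Two time intervals appear because, in the application, the regular states
    live on both sides of the interaction time and the wave on one side only. *)
Lemma total_entropy_one_wave (s1 s2 t1 t2 t M : R) (Ul Ur : R -> R -> R * V)
    (w : shadow_wave V) :
  (forall x t, s1 < t < s2 ->
    continuous (fun p : R * R => eta (Ul (fst p) (snd p))) (x, t)) ->
  (forall x t, s1 < t < s2 ->
    continuous (fun p : R * R => eta (Ur (fst p) (snd p))) (x, t)) ->
  is_shadow_wave vel t1 t2 w -> s1 < t < s2 -> t1 < t < t2 ->
  continuous H (val w t) -> - M < center w t < M ->
  is_total_entropy eta M (one_wave_net Ul w Ur) t
    (RInt (fun x => eta (Ul x t)) (- M) (center w t)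
     + (strength w t * H (val w t) + RInt (fun x => eta (Ur x t)) (center w t) M)).
Proof.
  intros HUl HUr Hw Hs Ht HH HM.
  destruct (strip_ends_lim _ _ _ _ Hw Ht) as [Hlo Hhi].
  exists (fun eps => RInt (fun x => eta (Ul x t)) (- M) (lo w eps t)
    + ((hi w eps t - lo w eps t) * eta (mid w eps t)
       + RInt (fun x => eta (Ur x t)) (hi w eps t) M)).
  split.
  - assert (E1 : at_right 0 (fun eps => - M < lo w eps t))
      by exact (Hlo _ (open_gt (- M) _ (proj1 HM))).
    assert (E2 : at_right 0 (fun eps => hi w eps t < M))
      by exact (Hhi _ (open_lt M _ (proj2 HM))).
    generalize (filter_and _ _ E1 (filter_and _ _ E2 (proj1 (Hw t Ht)))).
    apply filter_imp. intros eps (Hl & Hh & Hwidth).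
    apply (is_RInt_strip eta (fun x => Ul x t) (fun x => Ur x t)).
    + unfold lo, hi in *. lra.
    + lra.
    + now apply (is_RInt_eta_state s1 s2).
    + now apply (is_RInt_eta_state s1 s2).
  - repeat apply (filterlim_Rplus (at_right 0)).
    + apply (filterlim_RInt_param (at_right 0) (fun x t => eta (Ul x t)) s1 s2 t
        (fun _ => - M) (fun eps => lo w eps t) (fun _ => t)); trivial;
        apply filterlim_const.
    + now apply strip_entropy_lim with t1 t2.
    + apply (filterlim_RInt_param (at_right 0) (fun x t => eta (Ur x t)) s1 s2 t
        (fun eps => hi w eps t) (fun _ => M) (fun _ => t)); trivial;
        apply filterlim_const.
Qed.

Lemma total_entropy_two_waves (s1 s2 t1 t2 t M : R) (Ul Um Ur : R -> R -> R * V)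
    (wl wr : shadow_wave V) :
  (forall x t, s1 < t < s2 ->
    continuous (fun p : R * R => eta (Ul (fst p) (snd p))) (x, t)) ->
  (forall x t, s1 < t < s2 ->
    continuous (fun p : R * R => eta (Um (fst p) (snd p))) (x, t)) ->
  (forall x t, s1 < t < s2 ->
    continuous (fun p : R * R => eta (Ur (fst p) (snd p))) (x, t)) ->
  is_shadow_wave vel t1 t2 wl -> is_shadow_wave vel t1 t2 wr ->
  s1 < t < s2 -> t1 < t < t2 ->
  continuous H (val wl t) -> continuous H (val wr t) ->
  - M < center wl t -> center wl t < center wr t -> center wr t < M ->
  is_total_entropy eta M (two_wave_net Ul wl Um wr Ur) t
    (RInt (fun x => eta (Ul x t)) (- M) (center wl t)
     + (strength wl t * H (val wl t)
        + (RInt (fun x => eta (Um x t)) (center wl t) (center wr t)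
           + (strength wr t * H (val wr t)
              + RInt (fun x => eta (Ur x t)) (center wr t) M)))).
Proof.
  intros HUl HUm HUr Hwl Hwr Hs Ht HHl HHr HMl Hlr HMr.
  destruct (strip_ends_lim _ _ _ _ Hwl Ht) as [Hlol Hhil].
  destruct (strip_ends_lim _ _ _ _ Hwr Ht) as [Hlor Hhir].
  exists (fun eps => RInt (fun x => eta (Ul x t)) (- M) (lo wl eps t)
    + ((hi wl eps t - lo wl eps t) * eta (mid wl eps t)
       + (RInt (fun x => eta (Um x t)) (hi wl eps t) (lo wr eps t)
          + ((hi wr eps t - lo wr eps t) * eta (mid wr eps t)
             + RInt (fun x => eta (Ur x t)) (hi wr eps t) M)))).
  split.
  (* The midpoint of the centers separates the two strips for small [eps]. *)
  - set (c := (center wl t + center wr t) / 2).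
    assert (E1 : at_right 0 (fun eps => - M < lo wl eps t))
      by exact (Hlol _ (open_gt (- M) _ HMl)).
    assert (E2 : at_right 0 (fun eps => hi wl eps t < c)).
    { apply (Hhil (fun x => x < c)). apply (open_lt c). unfold c. lra. }
    assert (E3 : at_right 0 (fun eps => c < lo wr eps t)).
    { apply (Hlor (fun x => c < x)). apply (open_gt c). unfold c. lra. }
    assert (E4 : at_right 0 (fun eps => hi wr eps t < M))
      by exact (Hhir _ (open_lt M _ HMr)).
    generalize (filter_and _ _ (filter_and _ _ E1 E2) (filter_and _ _
      (filter_and _ _ E3 E4)
      (filter_and _ _ (proj1 (Hwl t Ht)) (proj1 (Hwr t Ht))))).
    apply filter_imp. intros eps ((H1 & H2) & (H3 & H4) & H5 & H6).
    assert (lo wl eps t <= hi wl eps t) by (unfold lo, hi; lra).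
    assert (lo wr eps t <= hi wr eps t) by (unfold lo, hi; lra).
    (* The left strip is split off first; everything to its right is a one-wave net, to which the
       same splitting applies again. *)
    apply (is_RInt_strip eta (fun x => Ul x t)
             (fun x => one_wave_net Um wr Ur eps x t)); try lra.
    + now apply (is_RInt_eta_state s1 s2).
    + apply (is_RInt_strip eta (fun x => Um x t) (fun x => Ur x t)); try lra;
        now apply (is_RInt_eta_state s1 s2).
  - repeat apply (filterlim_Rplus (at_right 0)).
    + apply (filterlim_RInt_param (at_right 0) (fun x t => eta (Ul x t)) s1 s2 t
        (fun _ => - M) (fun eps => lo wl eps t) (fun _ => t)); trivial;
        apply filterlim_const.
    + now apply strip_entropy_lim with t1 t2.
    + apply (filterlim_RInt_param (at_right 0) (fun x t => eta (Um x t)) s1 s2 t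
        (fun eps => hi wl eps t) (fun eps => lo wr eps t) (fun _ => t)); trivial;
        apply filterlim_const.
    + now apply strip_entropy_lim with t1 t2.
    + apply (filterlim_RInt_param (at_right 0) (fun x t => eta (Ur x t)) s1 s2 t
        (fun eps => hi wr eps t) (fun _ => M) (fun _ => t)); trivial;
        apply filterlim_const.
Qed.

(** * Comparison of the entropies across the interaction time *)

Lemma interaction_strengths_ge0 (laws : conservation_laws V)
    (T0 T T1 : R) (Ul Um Ur : R -> R -> R * V) (wl wr w : shadow_wave V) :
  interaction laws vel T0 T T1 Ul Um Ur wl wr w ->
  0 <= strength wl T /\ 0 <= strength wr T.
Proof.
  intros Hint.
  assert (Hge : forall w', is_shadow_wave vel T0 T w' ->
            attains_limits (at_left T) T w' -> 0 <= strength w' T).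
  { intros w' Hw (_ & X & _).
    (* Strengths are positive before [T], and the value at [T] is a left limit; only the weak
       inequality survives. *)
    apply (filterlim_le (F := at_left T) (fun _ => 0) (strength w') 0 (strength w' T)).
    - generalize (at_left_Ioo T0 T (proj1 (int_times _ _ _ _ _ _ _ _ _ _ _ Hint))).
      apply filter_imp. intros t Ht. left. now apply (Hw t Ht).
    - apply filterlim_const.
    - exact X. }
  split; apply Hge; apply Hint.
Qed.

(* The regular parts of the entropy are continuous through [T], so only the
   contributions of the waves have to be compared. *)
Lemma total_entropy_decreases_of_strip_le (laws : conservation_laws V)
    (T0 T T1 M : R) (Ul Um Ur : R -> R -> R * V) (wl wr w : shadow_wave V) :
  interaction laws vel T0 T T1 Ul Um Ur wl wr w ->
  (forall x t, T0 < t < T1 ->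
     continuous H (snd (Ul x t)) /\ continuous H (snd (Um x t)) /\
     continuous H (snd (Ur x t))) ->
  (forall t, T0 < t <= T -> continuous H (val wl t) /\ continuous H (val wr t)) ->
  (forall t, T <= t < T1 -> continuous H (val w t)) ->
  strength w T * H (val w T)
    <= strength wl T * H (val wl T) + strength wr T * H (val wr T) ->
  Rabs (center w T) < M ->
  total_entropy_decreases eta M T
    (two_wave_net Ul wl Um wr Ur) (one_wave_net Ul w Ur).
Proof.
  intros Hint HHU HHlr HHw Hle HM.
  destruct Hint as [Htimes HUl HUm HUr Hwl Hwr Hw _ _ Hord (Cl & Xl & Vl)
    (Cr & Xr & Vr) (C & X & W) Ml Mr _ _].
  pose proof (continuous_eta_state _ _ _ HUl (fun x t Ht => proj1 (HHU x t Ht)))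
    as Kl.
  pose proof (continuous_eta_state _ _ _ HUm
    (fun x t Ht => proj1 (proj2 (HHU x t Ht)))) as Km.
  pose proof (continuous_eta_state _ _ _ HUr
    (fun x t Ht => proj2 (proj2 (HHU x t Ht)))) as Kr.
  apply Rabs_def2 in HM.
  assert (HTl : T0 < T <= T) by lra.
  assert (HTw : T <= T < T1) by lra.
  pose proof (at_left_Ioo T0 T (proj1 Htimes)) as HL.
  pose proof (at_right_Ioo T T1 (proj2 Htimes)) as HR.
  assert (IL : filterlim (fun t : R => t) (at_left T) (locally T))
    by apply filter_le_within.
  assert (IR : filterlim (fun t : R => t) (at_right T) (locally T))
    by apply filter_le_within.
  (* The entropies are filled in by unification with the formulas for two waves and for one wave,
     and the one-sided limits with the termwise limits of those formulas. *)
  eexists _, _, _, _. repeat split.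
  - assert (E1 : at_left T (fun t => - M < center wl t)).
    { apply (Cl (fun x => - M < x)). apply (open_gt (- M)). lra. }
    assert (E2 : at_left T (fun t => center wr t < M)).
    { apply (Cr (fun x => x < M)). apply (open_lt M). lra. }
    generalize (filter_and _ _ HL (filter_and _ _ E1 E2)).
    apply filter_imp. intros t (Ht & H1 & H2).
    destruct (HHlr t) as [HHl HHr]; [lra |].
    apply (total_entropy_two_waves T0 T1 T0 T); trivial; [lra | now apply Hord].
  - assert (E1 : at_right T (fun t => - M < center w t)).
    { apply (C (fun x => - M < x)). apply (open_gt (- M)). lra. }
    assert (E2 : at_right T (fun t => center w t < M)).
    { apply (C (fun x => x < M)). apply (open_lt M). lra. }
    generalize (filter_and _ _ HR (filter_and _ _ E1 E2)).
    apply filter_imp. intros t (Ht & H1 & H2).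
    apply (total_entropy_one_wave T0 T1 T T1); trivial; [lra | apply HHw; lra | lra].
  - repeat apply (filterlim_Rplus (at_left T)).
    + apply (filterlim_RInt_param (at_left T) (fun x t => eta (Ul x t)) T0 T1 T
        (fun _ => - M) (center wl) (fun t => t)); trivial;
        [apply filterlim_const | exact Cl].
    + apply (filterlim_Rmult (at_left T)); [exact Xl |].
      exact (filterlim_comp _ _ _ _ H _ _ _ Vl (proj1 (HHlr T HTl))).
    + apply (filterlim_RInt_param (at_left T) (fun x t => eta (Um x t)) T0 T1 T
        (center wl) (center wr) (fun t => t)); trivial; [exact Cl | exact Cr].
    + apply (filterlim_Rmult (at_left T)); [exact Xr |].
      exact (filterlim_comp _ _ _ _ H _ _ _ Vr (proj2 (HHlr T HTl))).
    + apply (filterlim_RInt_param (at_left T) (fun x t => eta (Ur x t)) T0 T1 T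
        (center wr) (fun _ => M) (fun t => t)); trivial;
        [exact Cr | apply filterlim_const].
  - repeat apply (filterlim_Rplus (at_right T)).
    + apply (filterlim_RInt_param (at_right T) (fun x t => eta (Ul x t)) T0 T1 T
        (fun _ => - M) (center w) (fun t => t)); trivial;
        [apply filterlim_const | exact C].
    + apply (filterlim_Rmult (at_right T)); [exact X |].
      exact (filterlim_comp _ _ _ _ H _ _ _ W (HHw T HTw)).
    + apply (filterlim_RInt_param (at_right T) (fun x t => eta (Ur x t)) T0 T1 T
        (center w) (fun _ => M) (fun t => t)); trivial;
        [exact C | apply filterlim_const].
  (* At [T] all centers coincide: the outer integrals agree on both sides and the middle one is over
     a single point, which leaves the strip inequality. *)
  - rewrite Ml, Mr, (RInt_point (V := R_CompleteNormedModule)).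
    change (@zero R_CompleteNormedModule) with 0. lra.
Qed.

End Waves.

(** * Convexity *)

(** The mean value theorem gives [f y - f x = f'(c) (y - x)] with [c] between [x] and [y]. Applied
    again to [f'], it shows that [f'(c) - f'(x)] is a nonnegative multiple of [c - x], which never
    has the sign opposite to [y - x]. *)
Lemma convex_above_tangent (f : R -> R) (J : R -> Prop) :
  is_open_interval J ->
  (forall x, J x -> twice_derivable_at f x /\ 0 <= Derive_n f 2 x) ->
  forall x y, J x -> J y -> f x + Derive f x * (y - x) <= f y.
Proof.
  intros [_ HJ] Hf x y Hx Hy.
  (* Convexity of [J] for unordered endpoints, matching the form of [MVT_gen]. *)
  assert (HB : forall a b z, J a -> J b -> Rmin a b <= z <= Rmax a b -> J z).
  { intros a b z Ha Hb Hz. unfold Rmin, Rmax in Hz.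
    destruct (Rle_dec a b); [apply (HJ a b) | apply (HJ b a)]; trivial. }
  destruct (MVT_gen f x y (Derive f)) as (c & Hc & Hfc).
  { intros z Hz. apply Derive_correct.
    apply (Hf z). apply (HB x y); trivial; lra. }
  { intros z Hz. apply continuity_pt_filterlim.
    apply (ex_derive_continuous (K := R_AbsRing) (V := R_NormedModule)).
    apply (Hf z). now apply (HB x y). }
  assert (Jc : J c) by now apply (HB x y).
  destruct (MVT_gen (Derive f) x c (Derive (Derive f))) as (d & Hd & Hfd).
  { intros z Hz. apply Derive_correct.
    apply (Hf z). apply (HB x c); trivial; lra. }
  { intros z Hz. apply continuity_pt_filterlim.
    apply (ex_derive_continuous (K := R_AbsRing) (V := R_NormedModule)).
    apply (Hf z). now apply (HB x c). }
  assert (Jd : J d) by now apply (HB x c).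
  pose proof (proj2 (Hf d Jd)) as Hd2.
  change (0 <= Derive (Derive f) d) in Hd2.
  assert (0 <= (c - x) * (y - x)).
  { unfold Rmin, Rmax in Hc. destruct (Rle_dec x y); nra. }
  assert (0 <= (Derive f c - Derive f x) * (y - x)) by (rewrite Hfd; nra).
  nra.
Qed.

(** The loss is the weighted variance [a (u - m)^2 + b (v - m)^2]. The mean [m] is given by a
    product equation, so no division by [a + b] occurs and zero weights are allowed. *)
Lemma merged_kinetic_energy_le (a b u v m : R) :
  0 <= a -> 0 <= b -> (a + b) * m = a * u + b * v ->
  (a + b) * m ^ 2 <= a * u ^ 2 + b * v ^ 2.
Proof.
  intros Ha Hb Hm.
  assert (0 <= a * (u - m) ^ 2 + b * (v - m) ^ 2).
  { apply Rplus_le_le_0_compat; apply Rmult_le_pos; trivial; apply pow2_ge_0. }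
  (* By the equation for [m] the cross term is [2 (a + b) m^2]. *)
  replace (a * u ^ 2 + b * v ^ 2)
    with (a * (u - m) ^ 2 + b * (v - m) ^ 2 + 2 * m * (a * u + b * v) - (a + b) * m ^ 2)
    by ring.
  rewrite <- Hm. lra.
Qed.

(** The tangent inequalities at [m], weighted by [a] and [b], are added; the linear terms combine
    into the last hypothesis. Its sign condition covers both an exact weighted mean [m] and a
    nonincreasing [f] with [m] above the mean. *)
Lemma merged_jensen_le (f : R -> R) (J : R -> Prop) (a b x y m : R) :
  is_open_interval J ->
  (forall x, J x -> twice_derivable_at f x /\ 0 <= Derive_n f 2 x) ->
  J x -> J y -> J m -> 0 <= a -> 0 <= b ->
  0 <= Derive f m * (a * x + b * y - (a + b) * m) ->
  (a + b) * f m <= a * f x + b * f y.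
Proof.
  intros HJ Hf Hx Hy Hm Ha Hb Hd.
  pose proof (convex_above_tangent f J HJ Hf m x Hm Hx) as Tx.
  pose proof (convex_above_tangent f J HJ Hf m y Hm Hy) as Ty.
  apply (Rmult_le_compat_l a) in Tx; trivial.
  apply (Rmult_le_compat_l b) in Ty; trivial.
  lra.
Qed.

(** * The two pressureless gas systems *)

Lemma is_open_interval_True : is_open_interval (fun _ => True).
Proof. split; [exact open_true | trivial]. Qed.

Theorem theorem6p1 :
  (forall (T0 T T1 M : R) (Ul Um Ur : R -> R -> R * R)
          (wl wr w : shadow_wave R_UniformSpace),
     interaction pressureless2 vel2 T0 T T1 Ul Um Ur wl wr w ->
     Rabs (center w T) < M ->
     total_entropy_decreases eta2 M T
       (two_wave_net Ul wl Um wr Ur) (one_wave_net Ul w Ur))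
  /\
  (forall (Ru Se : R -> R) (J : R -> Prop)
          (T0 T T1 M : R) (Ul Um Ur : R -> R -> R * (R * R))
          (wl wr w : shadow_wave (prod_UniformSpace R_UniformSpace R_UniformSpace)),
     (forall u, twice_derivable_at Ru u /\ 0 <= Derive_n Ru 2 u) ->
     is_open_interval J ->
     (forall e, J e ->
        twice_derivable_at Se e /\ Derive Se e <= 0 /\ 0 <= Derive_n Se 2 e) ->
     (forall x t, T0 < t < T1 ->
        J (energy3 (snd (Ul x t))) /\ J (energy3 (snd (Um x t))) /\
        J (energy3 (snd (Ur x t)))) ->
     (forall t, T0 < t <= T -> J (energy3 (val wl t)) /\ J (energy3 (val wr t))) ->
     (forall t, T <= t < T1 -> J (energy3 (val w t))) ->
     interaction pressureless3 vel3 T0 T T1 Ul Um Ur wl wr w ->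
     total_energy w T = total_energy wl T + total_energy wr T ->
     Rabs (center w T) < M ->
     total_entropy_decreases (eta3 Ru Se) M T
       (two_wave_net Ul wl Um wr Ur) (one_wave_net Ul w Ur)).

Proof.
  split.
  - intros T0 T T1 M Ul Um Ur wl wr w Hint HM.
    destruct (interaction_strengths_ge0 _ _ _ _ _ _ _ _ _ _ _ Hint) as [Hl Hr].
    assert (HH : forall u : R, continuous (fun u : R => u ^ 2 / 2) u).
    { intros u. apply (ex_derive_continuous (K := R_AbsRing) (V := R_NormedModule)).
      auto_derive. trivial. }
    apply (total_entropy_decreases_of_strip_le vel2 eta2 (fun u : R => u ^ 2 / 2))
      with (2 := Hint); auto.
    + intros [rho u]. simpl. field.
    (* With [H u = u ^ 2 / 2] the strip inequality is half of the kinetic energy inequality. *)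
    + pose proof (int_momentum _ _ _ _ _ _ _ _ _ _ _ Hint) as Hmom.
      rewrite (int_mass _ _ _ _ _ _ _ _ _ _ _ Hint) in Hmom |- *.
      generalize (merged_kinetic_energy_le _ _ _ _ _ Hl Hr Hmom).
      unfold vel2. lra.
  - intros Ru Se J T0 T T1 M Ul Um Ur wl wr w HR HJ HS HJU HJlr HJw Hint Hen HM.
    destruct (interaction_strengths_ge0 _ _ _ _ _ _ _ _ _ _ _ Hint) as [Hl Hr].
    (* [Se] is known to be differentiable only on [J], so continuity of [H] is obtained where the
       internal energy lies in [J]. *)
    assert (HH : forall v : R * R, J (energy3 v) ->
              continuous (fun v : R * R => Ru (fst v) + Se (snd v)) v).
    { intros [u e] He.
      apply (continuous_plus (K := R_AbsRing) (V := R_NormedModule)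
               (fun v : R * R => Ru (fst v)) (fun v : R * R => Se (snd v))).
      - apply (continuous_comp (fun v : R * R => fst v) Ru).
        + apply continuous_fst.
        + apply (ex_derive_continuous (K := R_AbsRing) (V := R_NormedModule)).
          apply HR.
      - apply (continuous_comp (fun v : R * R => snd v) Se).
        + apply continuous_snd.
        + apply (ex_derive_continuous (K := R_AbsRing) (V := R_NormedModule)).
          now apply HS. }
    apply (total_entropy_decreases_of_strip_le vel3 (eta3 Ru Se)
      (fun v : R * R => Ru (fst v) + Se (snd v))) with (2 := Hint); trivial.
    + now intros [rho [u e]].
    + intros x t Ht. repeat split; apply HH; now apply HJU.
    + intros t Ht. split; apply HH; now apply HJlr.
    + intros t Ht. apply HH. now apply HJw.
    + pose proof (int_times _ _ _ _ _ _ _ _ _ _ _ Hint) as Ht.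
      destruct (HJlr T) as [Jl Jr]; [lra |].
      assert (Jw : J (energy3 (val w T))) by (apply HJw; lra).
      pose proof (int_momentum _ _ _ _ _ _ _ _ _ _ _ Hint) as Hmom.
      unfold total_energy in Hen.
      rewrite (int_mass _ _ _ _ _ _ _ _ _ _ _ Hint) in Hmom, Hen |- *.
      pose proof (merged_kinetic_energy_le _ _ _ _ _ Hl Hr Hmom) as Hkin.
      assert (HRu : (strength wl T + strength wr T) * Ru (vel3 (val w T))
        <= strength wl T * Ru (vel3 (val wl T)) + strength wr T * Ru (vel3 (val wr T))).
      (* Momentum conservation makes the new velocity the exact weighted mean, so the derivative
         condition becomes [0 <= 0]. *)
      { apply (merged_jensen_le Ru (fun _ => True)); auto using is_open_interval_True.
        rewrite Hmom. lra. }
      (* Merging loses kinetic energy, hence raises the internal energy above the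
         mean; [Se] is nonincreasing. *)
      assert (HSe : (strength wl T + strength wr T) * Se (energy3 (val w T))
        <= strength wl T * Se (energy3 (val wl T))
           + strength wr T * Se (energy3 (val wr T))).
      { apply (merged_jensen_le Se J); trivial.
        - intros e He. split; now apply HS.
        - pose proof (proj1 (proj2 (HS _ Jw))) as Hd.
          (* Both factors are nonpositive: the slope of [Se] by assumption, the other by subtracting
             the kinetic inequality from energy conservation. *)
          rewrite <- Rmult_opp_opp. apply Rmult_le_pos; lra. }
      unfold vel3, energy3 in HRu, HSe. lra.
Qed.
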